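(* For all integers $n\ge 1$, $k\ge 2$ and $r\ge 2$, we have \[\mathrm{ex}_r(n, \text{Berge-}K_k) \le \max\{\mathrm{ex}(n, K_k),\ \mathrm{ex}(n, K_r, K_k)\}.\]
   Context: All graphs and hypergraphs are finite and simple. A hypergraph $\mathcal{H}$ contains a Berge-$F$ (Berge copy of the graph $F$) if there are an injection $\varphi:V(F)\to V(\mathcal{H})$ and an injection $f:E(F)\to E(\mathcal{H})$ with $\{\varphi(u),\varphi(v)\}\subset f(uv)$ for every edge $uv\in E(F)$; otherwise it is Berge-$F$-free. $\mathrm{ex}_r(n,\text{Berge-}F)$ is the maximum number of hyperedges in an $n$-vertex $r$-uniform Berge-$F$-free hypergraph. A graph is $F$-free if it has no (not necessarily induced) subgraph isomorphic to $F$. $\mathrm{ex}(n,F)$ is the maximum number of edges, and $\mathrm{ex}(n,H,F)$ the maximum number of copies of $H$, in an $n$-vertex $F$-free graph. *)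

(* Defs.v *)
From mathcomp Require Import all_boot.

Set Implicit Arguments.
Unset Strict Implicit.
Unset Printing Implicit Defensive.

(* A hypergraph on the vertex set T is its set of hyperedges, so there are no
   repeated hyperedges; isolated vertices are recorded by T.  A simple graph is
   a 2-uniform hypergraph. *)
Definition hypergraph (T : finType) := {set {set T}}.

Definition uniform (r : nat) (T : finType) (H : hypergraph T) : bool :=
  [forall e in H, #|e| == r].

Definition simple_graph (T : finType) (G : hypergraph T) : bool := uniform 2 G.

Definition complete_graph (k : nat) : hypergraph 'I_k :=
  [set e : {set 'I_k} | #|e| == 2].

Definition image_edges (V T : finType) (F : hypergraph V) (phi : {ffun V -> T}) :
    hypergraph T :=
  [set phi @: e | e : {set V} in F].

Definition embedding (V T : finType) (F : hypergraph V) (G : hypergraph T)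
    (phi : {ffun V -> T}) : bool :=
  injectiveb phi && (image_edges F phi \subset G).

Definition graph_free (V T : finType) (F : hypergraph V) (G : hypergraph T) :
    bool :=
  ~~ [exists phi : {ffun V -> T}, embedding F G phi].

(* The copies of F in G are the (not necessarily induced) subgraphs of G
   isomorphic to F, as pairs (vertex set, edge set): two embeddings with the
   same image count once. *)
Definition copies (V T : finType) (F : hypergraph V) (G : hypergraph T) :
    {set {set T} * {set {set T}}} :=
  [set (phi @: [set: V], image_edges F phi)
     | phi : {ffun V -> T} & embedding F G phi].

(* For an edge e = uv of F, the set {phi u, phi v} is phi @: e.  Only the
   values of f on the edges of F matter. *)
Definition berge_free (V T : finType) (F : hypergraph V) (H : hypergraph T) :
    bool :=
  ~~ [exists phi : {ffun V -> T}, exists f : {ffun {set V} -> {set T}},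
        [&& injectiveb phi,
            dinjectiveb f (mem F),
            [forall e in F, f e \in H] &
            [forall e in F, phi @: e \subset f e]]].

Definition ex_berge (r n : nat) (V : finType) (F : hypergraph V) : nat :=
  \max_(H : {set {set 'I_n}} | uniform r H && berge_free F H) #|H|.

Definition ex (n : nat) (V : finType) (F : hypergraph V) : nat :=
  \max_(G : {set {set 'I_n}} | simple_graph G && graph_free F G) #|G|.

Definition ex_copies (n : nat) (U V : finType)
    (H : hypergraph U) (F : hypergraph V) : nat :=
  \max_(G : {set {set 'I_n}} | simple_graph G && graph_free F G) #|copies H G|.

(* Main.v *)
Require Import Defs.
From mathcomp Require Import all_boot zify.

(* Apply Hall's theorem to the incidence graph between hyperedges and the pairs
   of vertices they contain, on both sides of a set of hyperedges of maximal
   deficiency: a Berge-K_k-free hypergraph H yields a K_k-free graph with edges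
   coloured red and blue such that |H| is at most the number of red edges plus
   the number of blue r-cliques. Zykov symmetrization of nonadjacent vertices makes the graph
   complete multipartite with fewer than k parts; a second symmetrization, of
   the colours along red edges, makes "equal or red" an equivalence relation on
   the parts, so that blue is complete multipartite too. If blue has fewer than
   r classes there is no blue r-clique, and the total is at most the number of
   edges. Otherwise every red edge lies in an r-clique all of whose other pairs
   are blue, so recolouring all red edges blue does not decrease the total. *)

Set Implicit Arguments.
Unset Strict Implicit.
Unset Printing Implicit Defensive.

(** * Hall's theorem and its two-sided form at maximal deficiency *)

(** Induction on [#|A|]. If some nonempty proper subset is tight, match it into its neighbourhood
    and the rest outside; otherwise such subsets have a spare neighbour, so one element may take any
    of its neighbours. The value [y0] serves for empty [A]. *)
Lemma hall (X Y : finType) (y0 : Y) (N : X -> {set Y}) (A : {set X}) :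
    (forall S : {set X}, S \subset A -> #|S| <= #|\bigcup_(x in S) N x|) ->
  exists f : X -> Y, {in A &, injective f} /\ {in A, forall x, f x \in N x}.
Proof.
have [m] := ubnP #|A|; elim: m => // m IHm in N A *; rewrite ltnS => ltAm hallA.
have [->|[a aA]] := set_0Vmem A.
  by exists (fun=> y0); split=> [x y|x]; rewrite inE.
(* Both cases split off a part [S] matched into [B]. The last premise is Hall's condition for the
   rest outside [B], with [#|B|] added to both sides to avoid subtraction. *)
have combine (S : {set X}) (B : {set Y}) : S != set0 -> S \subset A ->
    (exists f : X -> Y, [/\ {in S &, injective f}, {in S, forall x, f x \in N x}
                         & {in S, forall x, f x \in B}]) ->
    (forall U : {set X}, U \subset A :\: S -> U != set0 ->
       #|U| + #|B| <= #|B :|: \bigcup_(x in U) N x|) ->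
    exists f : X -> Y, {in A &, injective f} /\ {in A, forall x, f x \in N x}.
  move=> S0 sSA [f [injf fN fB]] hallD.
  have ltDm : #|A :\: S| < m.
    apply: leq_trans ltAm; apply: proper_card; rewrite properE subsetDl /=.
    have [x xS] := set0Pn _ S0; apply/subsetPn; exists x; rewrite ?inE ?xS //.
    exact: (subsetP sSA).
  have [|g [injg gN]] := IHm (fun x => N x :\: B) _ ltDm.
    move=> U sU; have [->|U0] := eqVneq U set0; first by rewrite cards0.
    rewrite -(leq_add2r #|B|) (leq_trans (hallD U sU U0)) // addnC.
    apply: leq_trans (leq_card_setU _ _); apply: subset_leq_card.
    apply/subsetP=> y; rewrite !inE; have [//|yB] := boolP (y \in B).
    by case/bigcupP=> x xU yN; apply/bigcupP; exists x; rewrite // inE yB.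
  have gD x : x \in A -> x \notin S -> (g x \in N x) && (g x \notin B).
    by move=> xA xS; have := gN x; rewrite !inE xS xA andbC; apply.
  exists (fun x => if x \in S then f x else g x); split=> [x y xA yA|x xA] /=.
    have [xS|xS] := ifPn; have [yS|yS] := ifPn.
    - exact: injf.
    - by move=> e; have /andP[_] := gD y yA yS; rewrite -e fB.
    - by move=> e; have /andP[_] := gD x xA xS; rewrite e fB.
    - by apply: injg; rewrite inE ?xS ?yS.
  by have [xS|xS] := ifPn; [exact: fN | case/andP: (gD x xA xS)].
have [/existsP[S /and3P[S0 pSA /eqP cS]]|noS] := boolP [exists S : {set X},
    [&& S != set0, S \proper A & #|\bigcup_(x in S) N x| == #|S|]].
  have sSA := proper_sub pSA.
  have ltSm : #|S| < m by apply: leq_trans (proper_card pSA) ltAm.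
  have [f [injf fN]] := IHm N S ltSm (fun U sUS => hallA U (subset_trans sUS sSA)).
  apply: (combine S (\bigcup_(x in S) N x)) => //.
    exists f; split=> // x xS; apply/bigcupP; exists x => //; exact: fN.
  move=> U; rewrite subsetD => /andP[sUA dUS] _.
  have := hallA (S :|: U); rewrite subUset sUA sSA => /(_ isT).
  by rewrite bigcup_setU cardsU setIC disjoint_setI0 // cards0 subn0 cS addnC.
have [y yN] : exists y, y \in N a.
  apply/set0Pn; rewrite -card_gt0; have := hallA [set a].
  by rewrite sub1set aA big_set1 cards1; apply.
apply: (combine [set a] [set y]); rewrite ?sub1set //.
- by apply/set0Pn; exists a; rewrite inE.
- exists (fun=> y); split=> [x1 x2|x|x]; rewrite !inE //.
  + by move=> /eqP-> /eqP->.
  + by move/eqP->.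
move=> U; rewrite subsetD1 => /andP[sUA aU] U0; rewrite cards1 addn1.
apply: leq_trans (subset_leq_card (subsetUr _ _)).
rewrite ltn_neqAle hallA // andbT eq_sym.
move: noS; rewrite negb_exists => /forallP/(_ U); rewrite U0 properE sUA /=.
by have -> : A \subset U = false by apply/negbTE/subsetPn; exists a.
Qed.

(* A set A maximizing |A| - |N(A)| splits the bipartite graph in two: by
   maximality both Hall conditions below hold. *)
Lemma hall_split (X Y : finType) (x0 : X) (y0 : Y) (N : X -> {set Y})
    (H : {set X}) :
  exists A : {set X}, exists f : X -> Y, exists g : Y -> X,
    let B := \bigcup_(x in A) N x in
    [/\ A \subset H,
        {in H :\: A &, injective f} /\ {in H :\: A, forall x, f x \in N x :\: B}
      & {in B &, injective g} /\ {in B, forall y, g y \in A /\ y \in N (g y)}].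
Proof.
(* Adding [#|Y|] keeps the truncated subtraction exact, so [d] orders sets by deficiency. *)
pose d (A : {set X}) := #|A| + #|Y| - #|\bigcup_(x in A) N x|.
have [A sAH maxA] := @arg_maxnP _ set0 (fun A => A \subset H) d (sub0set H).
have leY (B : {set Y}) : #|B| <= #|Y| by exact: max_card.
have maxA' (S : {set X}) : S \subset H -> #|S| + #|\bigcup_(x in A) N x| <=
    #|A| + #|\bigcup_(x in S) N x|.
  move/maxA; rewrite /d; have := leY (\bigcup_(x in A) N x).
  have := leY (\bigcup_(x in S) N x); lia.
set B := \bigcup_(x in A) N x in maxA'.
have [S sS|f fP] := @hall X Y y0 (fun x => N x :\: B) (H :\: A).
  move: sS; rewrite subsetD => /andP[sSH dSA].
  have := maxA' (A :|: S); rewrite subUset sAH sSH => /(_ isT).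
  rewrite cardsU setIC disjoint_setI0 // cards0 subn0 bigcup_setU -/B.
  suff : #|B :|: \bigcup_(x in S) N x| <= #|B| + #|\bigcup_(x in S) (N x :\: B)|.
    lia.
  apply: leq_trans (leq_card_setU _ _); apply: subset_leq_card.
  apply/subsetP=> y; rewrite !inE; have [//|yB] := boolP (y \in B).
  by case/bigcupP=> x xU yN; apply/bigcupP; exists x; rewrite // inE yB.
exists A, f.
have [S sS|g [injg gN]] := @hall Y X x0 (fun y => [set x in A | y \in N x]) B.
  (* Deleting [D] from [A] removes all of [S] from the neighbourhood, so maximality forces
     [#|S| <= #|D|]. *)
  set D := \bigcup_(y in S) _.
  have sDA : D \subset A by apply/bigcupsP=> y _; apply/subsetP=> x; rewrite inE => /andP[].
  have := maxA' (A :\: D) (subset_trans (subsetDl _ _) sAH).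
  have : #|\bigcup_(x in A :\: D) N x| <= #|B :\: S|.
    apply/subset_leq_card/bigcupsP=> x; rewrite inE => /andP[xD xA].
    apply/subsetP=> y yN; rewrite inE; apply/andP; split.
      by apply: contra xD => yS; apply/bigcupP; exists y; rewrite // inE xA.
    by apply/bigcupP; exists x.
  rewrite !cardsD (setIidPr sDA) (setIidPr sS).
  have := subset_leq_card sDA; have := subset_leq_card sS; lia.
exists g; split=> //; split=> // y yB; by move: (gN y yB); rewrite inE => /andP[].
Qed.

(** * Zykov symmetrization of a two-coloured graph *)

Section Symmetrization.

Variables (T V : finType).
Implicit Types (R : rel V) (E : {set {set T}}) (A X : {set T}) (h g : T -> V).

(** The symmetrized graph is the pullback of a fixed [R] along [h]: vertices with equal values are
    clones, and the diagonal of [R] decides whether clones are adjacent. *)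
Definition clique_along R h A : bool :=
  [forall u in A, forall w in A, (u != w) ==> R (h u) (h w)].

Lemma clique_alongP R h A :
  reflect {in A &, forall u w, u != w -> R (h u) (h w)} (clique_along R h A).
Proof.
apply: (iffP forall_inP) => [cA u w uA wA uw|cA u uA].
  exact: (implyP (forall_inP (cA u uA) w wA)).
by apply/forall_inP=> w wA; apply/implyP; exact: cA.
Qed.

Definition ncliques E R h := #|[set A in E | clique_along R h A]|.

(* Count the cliques meeting X in exactly one vertex u by their trace B outside
   X: the number of possible B depends only on the image of u. For a set with
   two vertices in X, being a clique does not depend on g: either c is false,
   or the set is a pair contained in X. *)
Lemma ncliques_affine E R h X s (c : bool) (P : pred V) :
    symmetric R -> {in P &, forall a b, R a b = c} -> (c -> s = 1) ->
    (forall A, A \in E -> #|A| = s.+1) ->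
    (forall A, #|A| = s.+1 -> #|A :&: X| = 1 -> A \in E) ->
  exists C : nat, exists psi : V -> nat, forall g,
    {in X, forall u, g u \in P} -> {in ~: X, g =1 h} ->
    ncliques E R g = C + \sum_(u in X) psi (g u).
Proof.
move=> symR Rc cs Es sE.
pose tr a := [set B : {set T} | [&& B \subset ~: X, #|B| == s, clique_along R h B
                                  & [forall w in B, R a (h w)]]].
pose far := [set A in E | #|A :&: X| != 1].
exists #|[set A in far | (#|A :&: X| == 0) && clique_along R h A || (1 < #|A :&: X|) && c]|.
exists (fun a => #|tr a|) => g gP gh.
rewrite /ncliques -(cardsID [set A : {set T} | #|A :&: X| == 1]) addnC; congr (_ + _).
  apply: eq_card => A; rewrite !inE.
  have [AE|_] := boolP (A \in E); rewrite ?andbF //=.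
  have [->|A1] := eqVneq #|A :&: X| 1; first by [].
  rewrite /=.
  have [Agt|Ale] := ltnP 1 #|A :&: X|; rewrite /= ?andbF ?orbF.
    have -> /= : (#|A :&: X| == 0) = false by lia.
    have [u [w [uAX wAX uw]]] : exists u w, [/\ u \in A :&: X, w \in A :&: X & u != w].
      by apply/card_gt1P.
    move: uAX wAX; rewrite !inE => /andP[uA uX] /andP[wA wX].
    have Ruw := Rc _ _ (gP u uX) (gP w wX).
    apply/idP/idP => [/clique_alongP cA|cT]; first by rewrite -Ruw cA.
    have AX : A \subset X.
      apply/setIidPl/eqP; rewrite eqEcard subsetIl (Es A AE).
      by rewrite cs.
    by apply/clique_alongP=> x y xA yA _; rewrite Rc ?gP ?(subsetP AX).
  have [A0|A0] := eqVneq #|A :&: X| 0; rewrite ?A0 //=; last first.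
    by lia.
  have AX x : x \in A -> x \in ~: X.
    move=> xA; rewrite inE; apply/negP=> xX; move/eqP: A0; rewrite cards_eq0.
    by move/eqP/setP/(_ x); rewrite !inE xA xX.
  by apply/clique_alongP/clique_alongP=> cA x y xA yA xy;
    have := cA x y xA yA xy; rewrite !gh ?AX.
(* The map from [(u, B)] to [u |: B] is a bijection from [D] onto the cliques meeting [X] exactly
   once. *)
pose D := [set p : T * {set T} | (p.1 \in X) && (p.2 \in tr (g p.1))].
have -> : \sum_(u in X) #|tr (g u)| = #|D|.
  rewrite -sum1_card (eq_bigl (fun p => (p.1 \in X) && (p.2 \in tr (g p.1)))).
    by rewrite -(pair_big_dep _ (fun u B => B \in tr (g u)) (fun _ _ => 1)) /=;
      apply: eq_bigr => u _; rewrite sum1_card.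
  by move=> p; rewrite inE.
have trX u (B : {set T}) : u \in X -> B \subset ~: X -> ((u |: B) :&: X = [set u]) * (u \notin B).
  move=> uX BX; split; last by apply/negP=> /(subsetP BX); rewrite inE uX.
  apply/setP=> x; rewrite !inE; case: eqVneq => [->|_] //=.
  by apply/negP=> /andP[/(subsetP BX)]; rewrite inE => /negP.
rewrite -(card_in_imset (f := fun p => p.1 |: p.2) (D := D)); last first.
  move=> [u B] [w C]; rewrite !inE /= => /andP[uX /andP[BX _]] /andP[wX /andP[CX _]] e.
  have uw : u = w.
    by apply/set1P; rewrite -(trX w C wX CX).1 -e (trX u B uX BX).1 inE.
  rewrite -uw in e CX *; congr (_, _).
  by rewrite -(setU1K (trX u B uX BX).2) e setU1K // (trX u C uX CX).2.
apply: eq_card => A; rewrite !inE; apply/idP/imsetP.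
  move=> /andP[/andP[AE cA] /cards1P[u Au]].
  have /andP[uA uX] : (u \in A) && (u \in X) by rewrite -in_setI Au inE.
  have BX : A :\ u \subset ~: X.
    apply/subsetP=> x; rewrite !inE => /andP[xu xA]; apply: contra xu => xX.
    by rewrite -in_set1 -Au inE xA.
  exists (u, A :\ u); last by rewrite /= setD1K.
  rewrite !inE /= uX BX /=; apply/and3P; split.
  - by have := cardsD1 u A; rewrite uA (Es A AE) add1n => -[<-].
  - apply/clique_alongP=> x y xB yB xy; rewrite -!gh ?(subsetP BX) //.
    by apply: (clique_alongP _ _ _ cA) => //; [case/setD1P: xB|case/setD1P: yB].
  - apply/forall_inP=> w wB; rewrite -gh ?(subsetP BX) //.
    case/setD1P: wB => wu wA.
    by apply: (clique_alongP _ _ _ cA); rewrite // eq_sym.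
move=> [[u B] + ->]; rewrite [_ \in D]inE /= !inE.
move=> /andP[uX /and4P[BX /eqP cB /clique_alongP clB /forall_inP uB']].
have [AX uNB] := trX u B uX BX.
have cA : #|u |: B| = s.+1 by rewrite cardsU1 uNB cB.
rewrite AX cards1 eqxx sE ?AX ?cards1 //= andbT.
have uB w : w \in B -> R (g u) (g w).
  by move=> wB; rewrite (gh w) ?(subsetP BX) //; exact: uB'.
apply/clique_alongP=> x y /setU1P[->|xB] /setU1P[->|yB].
- by rewrite eqxx.
- by rewrite uB.
- by rewrite symR uB.
- by rewrite !gh ?(subsetP BX) //; exact: clB.
Qed.

(* As h varies over the maps that send the preimage X of {i, j} into {i, j}, the
   number of red pairs plus blue cliques is C + sum_(u in X) psi (h u), so it is
   maximized by a map constant on X. *)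
Lemma symmetrization (red blue : rel V) E r h0 :
    symmetric red -> symmetric blue -> irreflexive blue -> 0 < r ->
    (forall e, e \in E -> #|e| = 2) ->
    (forall u w, h0 u != h0 w -> [set u; w] \in E) ->
  let score h := ncliques E red h + ncliques [set A : {set T} | #|A| == r] blue h in
  exists h, [/\ forall u w, h0 u = h0 w -> h u = h w,
    forall u, exists w, h u = h0 w,
    forall u w, h u != h w -> ~~ blue (h u) (h w) ->
       red (h u) (h u) = red (h u) (h w) ->
       red (h w) (h w) = red (h u) (h w) -> False
    & score h0 <= score h].
Proof.
move=> symr symb irrb r0 E2 + score.
have [m] := ubnP #|h0 @: [set: T]|; elim: m => // m IHm in h0 *; rewrite ltnS => ltm hE.
(* Two values are merged only if blue is absent between them and red between them agrees with red
   inside each: then both relations are constant on the two values, as [ncliques_affine]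
   requires. *)
pose bad u w := [&& h0 u != h0 w, ~~ blue (h0 u) (h0 w), red (h0 u) (h0 u) == red (h0 u) (h0 w)
       & red (h0 w) (h0 w) == red (h0 u) (h0 w)].
have [/existsP[u0 /existsP[w0 /and4P[ij nb /eqP rii /eqP rjj]]]|nobad] :=
    boolP [exists u, exists w, bad u w]; last first.
  exists h0; split=> // [u|u w n1 n2 n3 n4]; first by exists u.
  move: nobad; rewrite negb_exists => /forallP/(_ u); rewrite negb_exists => /forallP/(_ w).
  by rewrite /bad n1 n2 n3 n4 !eqxx.
set i := h0 u0 in ij nb rii rjj; set j := h0 w0 in ij nb rii rjj.
pose P := pred2 i j; pose X := [set u | P (h0 u)].
have [||||C1 [psi1 val1]] := @ncliques_affine E red h0 X 1 (red i j) P symr.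
- by move=> a b /pred2P[->|->] /pred2P[->|->] //; rewrite symr.
- by [].
- by [].
(* Since [X] is a union of fibres of [h0], a pair meeting [X] once has distinct values and lies in
   [E] by [hE]. *)
- move=> A /eqP/cards2P[u [w [uw ->]]].
  have [hu|hw] := eqVneq (h0 u) (h0 w); last by rewrite hE.
  rewrite (_ : _ :&: X = if u \in X then [set u; w] else set0).
    by case: ifP; rewrite ?cards2 ?uw ?cards0.
  apply/setP=> x; rewrite !inE; case: ifP => hX; rewrite !inE.
    case: eqVneq => [->|_] /=; first by [].
    by case: eqVneq => [->|_] //=; rewrite -hu.
  case: eqVneq => [->|_] /=; first by [].
  by case: eqVneq => [->|_] //=; rewrite -hu.
have [||||C2 [psi2 val2]] := @ncliques_affine [set A : {set T} | #|A| == r] blue h0 X r.-1 false P symb.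
- move=> a b /pred2P[->|->] /pred2P[->|->]; rewrite ?irrb ?(negbTE nb) //.
  by rewrite symb (negbTE nb).
- by [].
- by move=> A; rewrite inE => /eqP->; rewrite prednK.
- by move=> A; rewrite prednK // inE => ->.
pose psi a := psi1 a + psi2 a.
have valE g : {in X, forall u, g u \in P} -> {in ~: X, g =1 h0} ->
    score g = C1 + C2 + \sum_(u in X) psi (g u).
  by move=> gP gh; rewrite /score val1 // val2 // big_split /= addnACA.
have [a [Pa maxa]] : exists a, a \in P /\ forall b, b \in P -> psi b <= psi a.
  have [le|lt] := leqP (psi i) (psi j).
    by exists j; split=> [|b /pred2P[->|->]] //; rewrite !inE eqxx ?orbT.
  exists i; split=> [|b /pred2P[->|->]] //; rewrite ?inE ?eqxx //; exact: ltnW.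
pose h u := if u \in X then a else h0 u.
have le_h : score h0 <= score h.
  rewrite !valE //; last 3 first.
  - by move=> u uX; rewrite /h uX.
  - by move=> u; rewrite inE /h => /negbTE->.
  - by move=> u; rewrite inE.
  rewrite leq_add2l; apply: leq_sum => u uX; rewrite /h uX; apply: maxa.
  by move: uX; rewrite inE.
have hcomp u w : h0 u = h0 w -> h u = h w by move=> e; rewrite /h !inE e.
have hval u : exists w, h u = h0 w.
  rewrite /h; case: ifP => _; last by exists u.
  by case/pred2P: Pa => ->; [exists u0|exists w0].
have [||h1 [c1 v1 n1 l1]] := IHm h.
- apply: leq_trans ltm; apply: proper_card; apply/properP; split.
    by apply/subsetP=> _ /imsetP[u _ ->]; have [w ->] := hval u; exact: imset_f.
  (* The value among [i] and [j] that was not chosen leaves the image, so the induction measure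
     drops. *)
  have [b [Pb ba]] : exists b, b \in P /\ b != a.
    by case/pred2P: Pa => ->; [exists j|exists i]; rewrite ?inE ?eqxx ?orbT // eq_sym.
  exists b; first by case/pred2P: Pb => ->; exact: imset_f.
  apply/imsetP=> -[u _]; rewrite /h; case: ifP => [_ /eqP|]; first by rewrite (negbTE ba).
  by rewrite inE => + e; rewrite -e => /negP[].
- move=> u w uw; apply: hE; apply: contra uw => /eqP e; exact/eqP/hcomp.
exists h1; split=> //.
- by move=> u w /hcomp; exact: c1.
- by move=> u; have [w ->] := v1 u; exact: hval.
- exact: leq_trans l1.
Qed.

End Symmetrization.

(** * From Berge-free hypergraphs to red-blue graphs *)

(** Blue consists of the pairs inside members of [A], red of the pairs matched to the other
    hyperedges. The two matchings of [hall_split] send distinct coloured edges to distinct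
    hyperedges containing them, so a copy of [F] in the union would lift to a Berge copy. *)
Lemma berge_free_red_blue (U T : finType) (F : hypergraph U) (H : hypergraph T) :
    berge_free F H ->
  exists red blue : hypergraph T,
    [/\ simple_graph red, simple_graph blue, [disjoint red & blue],
        graph_free F (red :|: blue)
      & exists2 A : {set {set T}}, A \subset H & #|H| <= #|red| + #|A| /\
          {in A, forall B e : {set T}, e \subset B -> #|e| = 2 -> e \in blue}].
Proof.
move=> freeH.
pose N (B : {set T}) := [set e : {set T} | e \subset B & #|e| == 2].
have [A [f [g [sAH [injf fN] [injg gN]]]]] := hall_split set0 set0 N H.
set blue := \bigcup_(B in A) N B in fN injg gN.
pose red := f @: (H :\: A).
have redP e : e \in red -> exists B, [/\ B \in H, B \notin A, e = f B, e \in N B & e \notin blue].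
  case/imsetP=> B BHA ->; exists B; have := fN B BHA; rewrite inE => /andP[-> ->].
  by move: BHA; rewrite inE => /andP[-> ->].
have blue2 : simple_graph blue.
  by apply/forall_inP=> e /bigcupP[B _]; rewrite inE => /andP[].
exists red, blue; split=> //.
- by apply/forall_inP=> e /redP[B [_ _ _ + _]]; rewrite inE => /andP[].
- by rewrite disjoint_subset; apply/subsetP=> e /redP[B [_ _ _ _]].
- apply: contra freeH => /existsP[phi /andP[injphi /subsetP imG]].
  have [m [injm mP]] : exists m : {set T} -> {set T},
      {in red :|: blue &, injective m} /\
      {in red :|: blue, forall e, m e \in H /\ e \subset m e}.
    (* A red edge goes back to the hyperedge that [f] maps to it; on red edges the default [set0] is
       never reached. *)
    exists (fun e => if e \in blue then g e else
             odflt set0 [pick B in H :\: A | f B == e]).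
    have redm e : e \in red :|: blue -> e \notin blue ->
        exists2 B, [pick B in H :\: A | f B == e] = Some B & B \in H :\: A /\ f B = e.
      rewrite inE orbC => /orP[->//|/imsetP[B BHA eB] _].
      case: pickP => [B' /andP[B'H /eqP eB']|/(_ B)]; first by exists B'.
      by rewrite BHA eB eqxx.
    have bluem e : e \in blue -> g e \in A by move/gN=> [].
    split=> [e e' eG e'G|e eG].
      have [eb|eb] := ifPn; have [eb'|eb'] := ifPn.
      - exact: injg.
      - have [B -> [+ _]] := redm _ e'G eb'; rewrite inE => /andP[BA _] /= eB.
        by rewrite -eB bluem in BA.
      - have [B -> [+ _]] := redm _ eG eb; rewrite inE => /andP[BA _] /= eB.
        by rewrite eB bluem in BA.
      - by have [B -> [_ <-]] := redm _ eG eb; have [B' -> [_ <-]] := redm _ e'G eb' => /= ->.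
    have [eb|eb] := ifPn.
      have [gA] := gN e eb; rewrite inE => /andP[sub _]; split=> //.
      exact: (subsetP sAH).
    have [B -> [BHA eB]] := redm _ eG eb => /=.
    have := fN B BHA; rewrite eB !inE => /andP[_ /andP[-> _]].
    by case/setDP: BHA.
  have imE e : e \in F -> phi @: e \in red :|: blue by move=> eF; apply/imG/imset_f.
  apply/existsP; exists phi; apply/existsP; exists [ffun e : {set U} => m (phi @: e)].
  rewrite injphi /=; apply/and3P; split.
  - apply/dinjectiveP=> e e' eF e'F; rewrite !ffunE => /injm => /(_ (imE _ eF) (imE _ e'F)).
    by apply/imset_inj/injectiveP.
  - by apply/forall_inP=> e eF; rewrite ffunE; case: (mP _ (imE e eF)).
  - by apply/forall_inP=> e eF; rewrite ffunE; case: (mP _ (imE e eF)).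
exists A => //; split; last first.
  by move=> B BA e eB e2; apply/bigcupP; exists B; rewrite // inE eB e2 eqxx.
by rewrite card_in_imset // -(cardsID A H) (setIidPr sAH) addnC.
Qed.

(** * Cliques in complete multipartite graphs *)

Lemma card_le_inj (T : finType) (S : {set T}) m :
  m <= #|S| -> exists phi : {ffun 'I_m -> T}, injective phi /\ forall x, phi x \in S.
Proof.
move=> le; exists [ffun x => enum_val (widen_ord le x)]; split=> [x y|x]; rewrite !ffunE.
  by move/enum_val_inj/(congr1 val)=> /= /val_inj.
exact: enum_valP.
Qed.

Lemma complete_graph_free_clique (T : finType) (G : hypergraph T) k (S : {set T}) :
    graph_free (complete_graph k) G ->
    {in S &, forall u w, u != w -> [set u; w] \in G} -> #|S| < k.
Proof.
move=> freeG SG; rewrite ltnNge; apply: contra freeG => /card_le_inj[phi [injphi phiS]].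
apply/existsP; exists phi; apply/andP; split; first exact/injectiveP.
apply/subsetP=> _ /imsetP[e + ->]; rewrite inE => /cards2P[x [y [xy ->]]].
by rewrite imsetU1 imset_set1 SG // (inj_eq injphi).
Qed.

(** The complete multipartite graph whose parts are the fibres of [f]. *)
Definition multipartite (T V : finType) (f : T -> V) : hypergraph T :=
  [set e : {set T} | #|e| == 2 & #|f @: e| == 2].

Lemma multipartite_edge (T V : finType) (f : T -> V) u w :
  ([set u; w] \in multipartite f) = (f u != f w).
Proof.
rewrite inE imsetU1 imset_set1 !cards2.
have [_|fuw] := eqVneq (f u) (f w); first by rewrite andbF.
by have [uw|//] := eqVneq u w; rewrite uw eqxx in fuw.
Qed.

Lemma multipartite_simple (T V : finType) (f : T -> V) : simple_graph (multipartite f).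
Proof. by apply/forall_inP=> e; rewrite inE => /andP[]. Qed.

Lemma multipartite_free (T V : finType) (f : T -> V) k :
  #|f @: [set: T]| < k -> graph_free (complete_graph k) (multipartite f).
Proof.
apply: contraL => /existsP[phi /andP[_ /subsetP im]].
have injf : injective (f \o phi).
  move=> x y; apply: contra_eq => xy; rewrite /= -multipartite_edge; apply: im.
  apply/imsetP; exists [set x; y]; rewrite ?inE ?cards2 ?xy //.
  by rewrite imsetU1 imset_set1.
rewrite -leqNgt -[k in k <= _]card_ord -cardsT -(card_imset _ injf).
by apply/subset_leq_card/subsetP=> _ /imsetP[x _ ->]; exact: imset_f.
Qed.

(** An [r]-set on which [f] is injective spans a clique, and it is recovered as the vertex set of
    that copy. *)
Lemma copies_multipartite (T V : finType) (f : T -> V) r :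
  #|[set A : {set T} | #|A| == r & #|f @: A| == r]| <=
  #|copies (complete_graph r) (multipartite f)|.
Proof.
apply: leq_trans (leq_imset_card fst _); apply/subset_leq_card/subsetP=> A.
rewrite inE => /andP[/eqP cA /eqP fA].
have injf : {in A &, injective f} by apply/imset_injP; rewrite fA cA.
have [phi [injphi phiA]] := card_le_inj (eq_leq (esym cA)).
apply/imsetP; exists (phi @: [set: 'I_r], image_edges (complete_graph r) phi) => /=.
  apply: imset_f; rewrite inE; apply/andP; split; first exact/injectiveP.
  apply/subsetP=> _ /imsetP[e + ->]; rewrite inE => /cards2P[x [y [xy ->]]].
  rewrite imsetU1 imset_set1 multipartite_edge; apply: contra xy => /eqP e'.
  by apply/eqP/injphi/injf.
apply/esym/eqP; rewrite eqEcard card_imset // cardsT card_ord cA leqnn andbT.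
by apply/subsetP=> _ /imsetP[x _ ->].
Qed.

(* If g takes at least r values, an edge e with constant g-value extends to an
   r-set on which f is injective and e is the only pair where g collides. *)
Lemma multipartite_recolor (T V W : finType) (f : T -> V) (g : T -> W) r :
    (forall u w, f u = f w -> g u = g w) -> 2 <= r <= #|g @: [set: T]| ->
  #|[set e in multipartite f | #|g @: e| == 1]| +
     #|[set A : {set T} | #|A| == r & #|g @: A| == r]| <=
  #|[set A : {set T} | #|A| == r & #|f @: A| == r]|.
Proof.
move=> fg /andP[r2 rg].
(* Here [c] will be the common [g]-value of an edge, so [r.-2] further vertices complete it to an
   [r]-set. *)
have reps (c : W) : exists B : {set T}, [/\ #|B| = r.-2, {in B &, injective g} & {in B, forall u, g u != c}].
  have : r.-2 <= #|g @: [set: T] :\ c|.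
    by move: (cardsD1 c (g @: [set: T])); case: (c \in _); lia.
  case/card_le_inj=> phi [injphi phiS].
  have [t tP] : exists t : 'I_r.-2 -> T, forall x, g (t x) = phi x.
    have lift x : exists u, g u == phi x.
      by have /setD1P[_ /imsetP[u _ ->]] := phiS x; exists u.
    by exists (fun x => xchoose (lift x)) => x; apply/eqP/(xchooseP (lift x)).
  have injt : injective t by move=> x y e; apply: injphi; rewrite -!tP e.
  exists (t @: [set: _]); split.
  - by rewrite card_imset // cardsT card_ord.
  - by move=> _ _ /imsetP[x _ ->] /imsetP[y _ ->]; rewrite !tP => /injphi->.
  - by move=> _ /imsetP[x _ ->]; rewrite tP; have /setD1P[] := phiS x.
have [t0 _] : exists t0 : T, true.
  by have /card_gt0P[_ /imsetP[t0 _ _]] : 0 < #|g @: [set: T]| by lia.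
(* A vertex of [e] from which its common [g]-value is read off; [t0] covers only the empty set. *)
pose pt (e : {set T}) := odflt t0 [pick x in e].
have [b bP] := fin_all_exists reps.
pose extend e := e :|: b (g (pt e)).
set S := [set e in multipartite f | _].
have SP e : e \in S -> exists u w, [/\ e = [set u; w], f u != f w, g u = g w & g (pt e) = g u].
  rewrite inE => /andP[eM]; have := eM; rewrite inE => /andP[/cards2P[u [w [uw e_]]] _].
  move: eM; rewrite e_ multipartite_edge imsetU1 imset_set1 cards2 => fuw.
  have [guw _|//] := eqVneq (g u) (g w); exists u, w; split=> //.
  rewrite /pt; case: pickP => [x|/(_ u)]; rewrite !inE ?eqxx //.
  by case/pred2P=> ->.
have extend_collision e : e \in S -> {in extend e &, forall x y, x != y -> g x = g y -> e = [set x; y]}.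
  case/SP=> u [w [e_ _ guw gp]] x y.
  have [_ injb bc] := bP (g (pt e)).
  have ge z : z \in e -> g z = g (pt e) by rewrite gp {1}e_ !inE => /pred2P[->|->].
  case/setUP=> [xe|xB] /setUP[ye|yB] xy gxy.
  - apply/eqP; rewrite eq_sym eqEcard cards2 xy e_ cards2 andbC.
    by case: (u != w); rewrite -e_ subUset !sub1set xe ye.
  - by have := bc y yB; rewrite -gxy ge // eqxx.
  - by have := bc x xB; rewrite gxy ge // eqxx.
  - by move: xy; rewrite (injb x y) ?eqxx.
have extend_inj : {in S &, injective extend}.
  move=> e e' eS e'S e_e'; have [u [w [eu fuw guw _]]] := SP e' e'S.
  rewrite eu; apply: (extend_collision e eS) => //; last by apply: contraNneq fuw => ->.
  - by rewrite e_e' /extend eu !inE eqxx.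
  - by rewrite e_e' /extend eu !inE eqxx orbT.
have disj : [disjoint extend @: S & [set A : {set T} | #|A| == r & #|g @: A| == r]].
  rewrite disjoint_subset; apply/subsetP=> _ /imsetP[e eS ->]; rewrite !inE.
  apply/negP=> /andP[/eqP c1 /eqP c2]; have [u [w [eu fuw guw _]]] := SP e eS.
  have injg : {in extend e &, injective g} by apply/imset_injP; rewrite c1 c2.
  have uw : u = w by apply: injg; rewrite // /extend eu !inE eqxx ?orbT.
  by rewrite uw eqxx in fuw.
rewrite -(card_in_imset extend_inj) -cardsUI disjoint_setI0 // cards0 addn0.
apply/subset_leq_card/subsetP=> B /setUP[/imsetP[e eS ->]|]; rewrite !inE; last first.
  move=> /andP[cB /eqP gB]; rewrite cB -[X in _ == X](eqP cB) /=; apply/imset_injP=> x y xB yB /fg.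
  by apply: (imset_injP _ _ _) xB yB; rewrite gB (eqP cB).
have [u [w [eu fuw guw gp]]] := SP e eS; have [cb injb bc] := bP (g (pt e)).
have uw : u != w by apply: contraNneq fuw => ->.
have eb : e :&: b (g (pt e)) = set0.
  apply/setP=> x; rewrite in_set0 in_setI; apply/negP=> /andP[xe xb].
  have := bc x xb; rewrite gp; move: xe; rewrite {1}eu !inE => /pred2P[] ->.
    by rewrite eqxx.
  by rewrite guw eqxx.
have card_ext : #|extend e| = r.
  by rewrite /extend cardsU eb cards0 cb {1}eu cards2 uw; lia.
rewrite card_ext eqxx -[X in _ == X]card_ext /=; apply/imset_injP=> x y xe ye fxy.
(* A collision of [f] is one of [g], hence is the pair [e] itself, whose ends [f] separates. *)
apply: contraTeq fuw => xy; have := extend_collision e eS x y xe ye xy (fg _ _ fxy).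
rewrite eu => e2; rewrite -multipartite_edge e2 multipartite_edge fxy.
by rewrite eqxx.
Qed.

Theorem theorem19 (n k r : nat) (hn : 1 <= n) (hk : 2 <= k) (hr : 2 <= r) :
  ex_berge r n (complete_graph k) <=
    maxn (ex n (complete_graph k))
         (ex_copies n (complete_graph r) (complete_graph k)).
Proof.
apply/bigmax_leqP=> H /andP[/forall_inP unifH /berge_free_red_blue].
move=> [red [blue [/forall_inP red2 /forall_inP blue2 disj freeG [A sAH [leH A_blue]]]]].
pose R u w := [set u; w] \in red; pose B u w := [set u; w] \in blue.
have symR : symmetric R by move=> u w; rewrite /R setUC.
have symB : symmetric B by move=> u w; rewrite /B setUC.
have irrR : irreflexive R.
  by move=> u; apply/negP=> /red2; rewrite setUid cards1.
have irrB : irreflexive B.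
  by move=> u; apply/negP=> /blue2; rewrite setUid cards1.
have RB u w : R u w -> B u w -> False.
  by move=> uwR; rewrite /B (disjointFr disj uwR).
have r0 : 0 < r by lia.
(* First symmetrization: [R] and [B] are irreflexive, so the pairs merged are the nonadjacent
   ones. *)
have [||f [_ _ f_clique le_f]] :=
    @symmetrization _ _ R B [set e : {set 'I_n} | #|e| == 2] r id symR symB irrB r0.
- by move=> e; rewrite inE => /eqP.
- by move=> u w uw; rewrite inE cards2 uw.
have adj u w : f u != f w -> R (f u) (f w) || B (f u) (f w).
  move=> fuw; have [//|nB] := boolP (B _ _); rewrite ?orbT // orbF.
  by apply/negPn/negP=> /negbTE nR; apply: (f_clique u w); rewrite ?irrR ?nR.
have f_lt : #|f @: [set: 'I_n]| < k.
  apply: complete_graph_free_clique freeG _ => _ _ /imsetP[u _ ->] /imsetP[w _ ->].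
  by move/adj; rewrite inE.
(* With a reflexive red relation, the pairs that can be merged are now the red ones, and an edge of
   [multipartite f] whose ends merge still counts as red. *)
pose R' u w := (u == w) || R u w.
have symR' : symmetric R' by move=> u w; rewrite /R' eq_sym symR.
have [||h [h_f h_val h_clique le_h]] :=
    @symmetrization _ _ R' B (multipartite f) r f symR' symB irrB r0.
- by move=> e; rewrite inE => /andP[/eqP].
- by move=> u w; rewrite multipartite_edge.
have h_blue u w : h u != h w -> B (h u) (h w).
  have [[u' eu] [w' ew]] := (h_val u, h_val w).
  move=> huw; apply/negPn/negP=> nB; have := @adj u' w'.
  rewrite -eu -ew => /(_ huw); rewrite (negbTE nB) orbF => hR.
  by apply: (h_clique u w) => //; rewrite /R' hR eqxx orbT.
have le_red : ncliques (multipartite f) R' h <=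
    #|[set e in multipartite f | #|h @: e| == 1]|.
  apply/subset_leq_card/subsetP=> e; rewrite !in_set => /andP[eM cl].
  rewrite eM /=; have /cards2P[u [w [uw eE]]] : #|e| == 2 by case/andP: eM.
  have := clique_alongP _ _ _ cl u w; rewrite eE !inE !eqxx orbT => /(_ isT isT uw).
  rewrite imsetU1 imset_set1 cards2; have [//|huw] := eqVneq (h u) (h w).
  by rewrite /R' (negbTE huw) /= => hR; have := RB _ _ hR (h_blue u w huw).
have le_blue : ncliques [set S : {set 'I_n} | #|S| == r] B h <=
    #|[set S : {set 'I_n} | #|S| == r & #|h @: S| == r]|.
  apply/subset_leq_card/subsetP=> S; rewrite !inE => /andP[cS cl].
  rewrite cS -[X in _ == X](eqP cS); apply/imset_injP=> u w uS wS huw.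
  apply/eqP/negPn/negP=> uw; have := clique_alongP _ _ _ cl u w uS wS uw.
  by rewrite huw irrB.
have le_id : #|H| <= ncliques [set e : {set 'I_n} | #|e| == 2] R id
    + ncliques [set S : {set 'I_n} | #|S| == r] B id.
  apply: leq_trans leH _; apply: leq_add; apply/subset_leq_card/subsetP=> e.
    move=> eR; rewrite !inE red2 //=; have /cards2P[x [y [xy eE]]] := red2 e eR.
    apply/clique_alongP=> u w ue we uw; rewrite /R (_ : [set u; w] = e) //.
    by apply/eqP; rewrite eqEcard subUset !sub1set ue we eE !cards2 uw xy.
  move=> eA; rewrite !inE unifH ?(subsetP sAH) //=.
  apply/clique_alongP=> u w ue we uw; apply: (A_blue e eA).
    by rewrite subUset !sub1set ue.
  by rewrite cards2 uw.
(* Passing to [R'] and to the edges of [multipartite f] loses no red pair: irreflexivity of [R]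
   gives the ends of a red pair distinct [f]-values. *)
have le_f' : ncliques [set e : {set 'I_n} | #|e| == 2] R f <= ncliques (multipartite f) R' f.
  apply/subset_leq_card/subsetP=> e; rewrite !in_set => /andP[e2 /clique_alongP cl].
  have /cards2P[u [w [uw eE]]] := e2.
  have Ruw : R (f u) (f w) by apply: cl; rewrite ?eE ?inE ?eqxx ?orbT.
  apply/andP; split; last first.
    by apply/clique_alongP=> x y xe ye xy; rewrite /R' cl ?orbT.
  have := multipartite_edge f u w; rewrite -eE inE => ->.
  by apply: contraL Ruw => /eqP->; rewrite irrR.
have leT : #|H| <= #|[set e in multipartite f | #|h @: e| == 1]|
    + #|[set S : {set 'I_n} | #|S| == r & #|h @: S| == r]| by lia.
have fP : simple_graph (multipartite f) && graph_free (complete_graph k) (multipartite f).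
  by rewrite multipartite_simple multipartite_free.
rewrite leq_max; have [h_lt|h_ge] := ltnP #|h @: [set: 'I_n]| r.
  apply/orP; left; apply: leq_trans leT _.
  rewrite (_ : [set S : {set 'I_n} | #|S| == r & _] = set0) ?cards0 ?addn0; last first.
    apply/setP=> S; rewrite !inE; apply/negP=> /andP[_ /eqP hS].
    by move: h_lt; rewrite -hS ltnNge subset_leq_card // imsetS ?subsetT.
  apply: (@leq_trans #|multipartite f|).
    by apply/subset_leq_card/subsetP=> e; rewrite inE => /andP[].
  exact: (@leq_bigmax_cond _ _ (fun G : {set {set 'I_n}} => #|G|)).
apply/orP; right; apply: leq_trans leT _.
apply: leq_trans (multipartite_recolor h_f _) _; first by rewrite hr.
apply: leq_trans (copies_multipartite f r) _.
exact: (@leq_bigmax_cond _ _ (fun G : {set {set 'I_n}} => #|copies (complete_graph r) G|)).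
Qed.
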